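(* Let $d,m\ge 1$ be integers and $L,R,\beta,\varepsilon>0$. Let $W\subseteq\mathbb{R}^d$ be a nonempty closed convex set with $\|w\|\le R$ for all $w\in W$. Let $\ell_1,\dots,\ell_m:\mathbb{R}^d\to\mathbb{R}$ be differentiable loss functions (the losses on the $m$ training examples of $S$) of the form $\ell_i(w)=\bar\ell_i(\langle w,x_i\rangle)+\rho(w)$, where $x_i\in\mathbb{R}^d$ with $\|x_i\|\le 1$, $\bar\ell_i:\mathbb{R}\to\mathbb{R}$ is $L$-Lipschitz, and $\rho$ is a fixed function. Assume that each $\ell_i$ is convex, $L$-Lipschitz and $\beta$-smooth on $W$, and that $\sup_{i,\,w\in W}|\ell_i(w)|\le R$. Let $L_S(w)=\frac1m\sum_{i=1}^m\ell_i(w)$ and $L_S^*=\min_{w\in W}L_S(w)$. Let $\eta=\frac{R}{L\sqrt m}$ and assume $\eta\le 2/\beta$. Run 1-pass projected permutation-based SGD with constant step size $\eta$: with $\tau$ a uniformly random permutation of $[m]$ and $w_1\in W$ a starting point, set $w_{t+1}=\Pi_W\big(w_t-\eta\nabla\ell_{\tau(t)}(w_t)\big)$ for $1\le t<m$, and let $\bar w=\frac1m\sum_{t=1}^m w_t$. Let $\kappa\in\mathbb{R}^d$ be drawn independently of $\tau$ with density $p(\kappa)\propto\exp(-\varepsilon\|\kappa\|/\Delta_2)$, where $\Delta_2=2L\eta$, and let $\tilde w=\bar w+\kappa$. Then $$\mathbb{E}\big[L_S(\tilde w)-L_S^*\big]\le\frac{\big(L+2(12+\sqrt2\,L)\big)R}{\sqrt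 m}+\frac{2dLR}{\varepsilon\sqrt m}.$$
   Context: $\|\cdot\|$ is the Euclidean norm, $[m]=\{1,\dots,m\}$, and $\Pi_W$ is the Euclidean projection onto $W$. A function $f$ is $L$-Lipschitz on a set if $|f(u)-f(v)|\le L\|u-v\|$ for all $u,v$ in it; a differentiable $f$ is convex on $W$ if $f(u)\ge f(v)+\langle\nabla f(v),u-v\rangle$ for all $u,v\in W$, and $\beta$-smooth on $W$ if $\|\nabla f(u)-\nabla f(v)\|\le\beta\|u-v\|$ for all $u,v\in W$. The expectation is over $\tau$ and $\kappa$. The procedure is output perturbation of SGD: the noise is calibrated to the $L_2$-sensitivity bound $\Delta_2=2kL\eta$ for $k$ passes, here with $k=1$, and that algorithm requires $\eta\le 2/\beta$.
   Formalization: Each ℓ_i is assumed L-Lipschitz on all of R^d, not only on W; with Lipschitz continuity on W alone the claim fails, e.g. d=m=1, W=[-R,R], ρ(w)=M·max(0,|w|-R)² with M large, because w̃ leaves W. *)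

(* Defs.v *)
From HB Require Import structures.
From mathcomp Require Import all_boot all_order all_algebra all_fingroup.
From mathcomp Require Import all_classical all_reals all_analysis.

Set Implicit Arguments.
Unset Strict Implicit.
Unset Printing Implicit Defensive.

Import Order.TTheory GRing.Theory Num.Theory.
Import numFieldNormedType.Exports.

Local Open Scope classical_set_scope.
Local Open Scope ring_scope.

Section euclidean.
Context {R : realType} {d : nat}.
Implicit Types (u v w x : 'rV[R]_d) (f : 'rV[R]_d -> R) (W : set 'rV[R]_d).

Definition dotp u v : R := \sum_(i < d) u 0 i * v 0 i.

(* The library norm `|u| on 'rV[R]_d is the sup norm; it induces the same
   topology, so closed and differentiable are the library notions below. *)
Definition enorm u : R := Num.sqrt (dotp u u).

(* Meaningful where f is differentiable. *)
Definition grad f w : 'rV[R]_d := \row_(j < d) 'D_(delta_mx 0 j) f w.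

(* The library's k.-lipschitz_ W f is relative to the sup norm. The losses are
   to be Lipschitz in setT, their domain, and not merely in W: they are
   evaluated at the perturbed average, which leaves W, and a Lipschitz bound in
   W says nothing about the regularizer there. *)
Definition lipschitz_in W (L : R) f : Prop :=
  forall u v, W u -> W v -> `|f u - f v| <= L * enorm (u - v).

Definition convex_in W f : Prop :=
  forall u v, W u -> W v -> f v + dotp (grad f v) (u - v) <= f u.

Definition smooth_in W (beta : R) f : Prop :=
  forall u v, W u -> W v ->
    enorm (grad f u - grad f v) <= beta * enorm (u - v).

(* The nearest point exists and is unique when W is nonempty, closed and
   convex; the default value 0 is then never used. *)
Definition nearest_point W v : 'rV[R]_d :=
  xget 0 [set u | W u /\ forall z, W z -> enorm (v - u) <= enorm (v - z)].

Definition is_min_on W f (a : R) : Prop :=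
  (exists2 w, W w & f w = a) /\ forall w, W w -> a <= f w.

End euclidean.

Section sgd.
Context {R : realType} {d : nat}.
Variables (W : set 'rV[R]_d) (eta : R) (w1 : 'rV[R]_d).

(* The iterate reached from w1 after one projected step on each loss of s. *)
Definition sgd_iterate (s : seq ('rV[R]_d -> R)) : 'rV[R]_d :=
  foldl (fun w f => nearest_point W (w - eta *: grad f w)) w1 s.

(* The iterate w_{t+1} (t < m) has used the losses tau(1), ..., tau(t) only, so
   that the last loss is not used. *)
Definition sgd_average (m : nat) (l : 'I_m -> 'rV[R]_d -> R) (tau : 'S_m)
    : 'rV[R]_d :=
  m%:R^-1 *:
    \sum_(t < m) sgd_iterate (take t [seq l (tau i) | i <- enum 'I_m]).

End sgd.

Definition empirical_risk {R : realType} {d m : nat}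
    (l : 'I_m -> 'rV[R]_d -> R) (w : 'rV[R]_d) : R :=
  m%:R^-1 * \sum_(i < m) l i w.

(* The library has no measurable structure on 'rV[R]_d and no Lebesgue measure
   in dimension n. Random vectors are therefore valued in n.-tuple R (product
   sigma-algebra), on which Lebesgue measure is the iterated product. *)
Definition row_of_tuple {R : realType} {d : nat} (t : d.-tuple R) : 'rV[R]_d :=
  \row_(i < d) tnth t i.

Section lebesgue_cons.
Context {R : realType} (n : nat).
Variable mu : {sigma_finite_measure set (n.-tuple R) -> \bar R}.

Definition lebesgue_cons : set (n.+1.-tuple R) -> \bar R :=
  pushforward (@lebesgue_measure R \x mu)%E
    (fun xt : R * n.-tuple R => [tuple of xt.1 :: xt.2]).

Let mcons : measurable_fun [set: R * n.-tuple R]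
  (fun xt : R * n.-tuple R => [tuple of xt.1 :: xt.2]).
Proof. exact: measurable_cons. Qed.

Let cons0 : lebesgue_cons set0 = 0%E.
Proof. by rewrite /lebesgue_cons /pushforward preimage_set0 measure0. Qed.

Let cons_ge0 A : (0 <= lebesgue_cons A)%E.
Proof. exact: measure_ge0. Qed.

Let cons_sigma_additive : semi_sigma_additive lebesgue_cons.
Proof.
move=> F mF tF mUF; rewrite /lebesgue_cons /pushforward preimage_bigcup.
apply: measure_semi_sigma_additive.
- by move=> k; rewrite -[X in measurable X]setTI; exact: mcons.
- apply/trivIsetP => /= i j _ _ ij; rewrite -preimage_setI.
  by move/trivIsetP : tF => /(_ _ _ _ _ ij) ->//; rewrite preimage_set0.
- by rewrite -preimage_bigcup -[X in measurable X]setTI; exact: mcons.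
Qed.

HB.instance Definition _ := isMeasure.Build _ _ _ lebesgue_cons
  cons0 cons_ge0 cons_sigma_additive.

Lemma lebesgue_consE (A : set (measurableTypeR R)) (B : set (n.-tuple R)) :
  measurable A -> measurable B ->
  lebesgue_cons [set t | A (thead t) /\ B [tuple of behead t]] =
  (lebesgue_measure A * mu B)%E.
Proof.
move=> mA mB; rewrite -product_measure1E// /lebesgue_cons /pushforward.
congr ((_ \x _)%E _); apply/seteqP; split=> -[x t] /= [];
  rewrite theadE (_ : [tuple of behead [tuple of x :: t]] = t)//;
  exact/val_inj.
Qed.

Let cons_sigma_finite : sigma_finite setT lebesgue_cons.
Proof.
have /sigma_finiteP[F [FT Fnd Ffin]] :=
  sigma_finiteT (@lebesgue_measure R).
have /sigma_finiteP[G [GT Gnd Gfin]] := sigma_finiteT mu.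
exists (fun k => [set t | F k (thead t) /\ G k [tuple of behead t]]).
  apply/seteqP; split=> // t _.
  have : [set: R] (thead t) by []. rewrite FT => -[i _ Fi].
  have : [set: n.-tuple R] [tuple of behead t] by []. rewrite GT => -[j _ Gj].
  exists (maxn i j) => //; split.
    by move/subsetPset: (Fnd _ _ (leq_maxl i j)); exact.
  by move/subsetPset: (Gnd _ _ (leq_maxr i j)); exact.
move=> k; have [mF Foo] := Ffin k; have [mG Goo] := Gfin k; split.
  rewrite (_ : [set t | _] =
    (fun t : n.+1.-tuple R => thead t) @^-1` F k `&`
    (fun t : n.+1.-tuple R => [tuple of behead t]) @^-1` G k)//.
  apply: measurableI; rewrite -[X in measurable X]setTI.
    exact: (@measurable_tnth _ _ _ ord0).
  exact: measurable_behead.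
rewrite lebesgue_consE// lte_mul_pinfty//.
by rewrite ge0_fin_numE.
Qed.

HB.instance Definition _ := @Measure_isSigmaFinite.Build _ _ _ lebesgue_cons
  cons_sigma_finite.

End lebesgue_cons.

Fixpoint lebesgue_tuple {R : realType} (n : nat)
    : {sigma_finite_measure set (n.-tuple R) -> \bar R} :=
  match n with
  | 0%N => @dirac _ (0.-tuple R) [tuple] R
  | k.+1 => lebesgue_cons (@lebesgue_tuple R k)
  end.

Lemma lebesgue_tuple_box {R : realType} (n : nat)
    (A : 'I_n -> set (measurableTypeR R)) :
  (forall i, measurable (A i)) ->
  lebesgue_tuple n [set t : n.-tuple R | forall i, A i (tnth t i)] =
  (\prod_(i < n) lebesgue_measure (A i))%E.
Proof.
elim: n A => [|n ih] A mA; first by rewrite big_ord0 /= diracE mem_set//; case.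
rewrite big_ord_recl -ih// -lebesgue_consE//=; last first.
  pose B i := (fun t : n.-tuple R => tnth t i) @^-1` A (lift ord0 i).
  rewrite (_ : [set t | _] = \bigcap_(i in [set: 'I_n]) B i).
    apply: fin_bigcap_measurable => // i _; rewrite -[X in measurable X]setTI.
    by apply: (@measurable_tnth _ (measurableTypeR R) n i) => //; exact: mA.
  by apply/seteqP; split=> t /= tA i; [move=> _|]; exact: tA.
have tnth_behead (t : n.+1.-tuple R) i :
    tnth [tuple of behead t] i = tnth t (lift ord0 i).
  by rewrite [in RHS](tuple_eta t) tnthS.
congr (lebesgue_cons _ _); apply/seteqP; split=> t /=.
  by move=> tA; split=> [|i]; [|rewrite tnth_behead]; exact: tA.
move=> [t0 tS] i; case: (unliftP ord0 i) => [j ->|->//].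
by rewrite -tnth_behead.
Qed.

Section probability.
Context {R : realType} {dp : measure_display} {Omega : measurableType dp}.
Variable P : probability Omega R.

Definition uniform_perm (m : nat) (tau : Omega -> 'S_m) : Prop :=
  forall s : 'S_m, measurable (tau @^-1` [set s]) /\
    P (tau @^-1` [set s]) = ((m`!%:R)^-1)%:E.

(* T carries no sigma-algebra: for tau a uniform_perm, every set B of
   permutations has a measurable preimage. *)
Definition independent_of (T : Type) (tau : Omega -> T) (d : nat)
    (X : {RV P >-> d.-tuple R}) : Prop :=
  forall (B : set T) (A : set (d.-tuple R)),
    measurable (tau @^-1` B) -> measurable A ->
    P (tau @^-1` B `&` X @^-1` A) = (P (tau @^-1` B) * P (X @^-1` A))%E.

Definition has_density (d : nat) (X : {RV P >-> d.-tuple R})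
    (p : 'rV[R]_d -> R) : Prop :=
  forall A : set (d.-tuple R), measurable A ->
    distribution P X A = (\int[lebesgue_tuple d]_(x in A) (p (row_of_tuple x))%:E)%E.

(* The density of X is proportional to q; the normalizing constant c is forced
   by the total mass being 1. *)
Definition has_density_prop (d : nat) (X : {RV P >-> d.-tuple R})
    (q : 'rV[R]_d -> R) : Prop :=
  exists c : R, has_density X (fun x => c * q x).

End probability.

(* Main.v *)
Require Import Defs.
From mathcomp Require Import all_boot all_order all_algebra all_fingroup.
From mathcomp Require Import ring lra.
From mathcomp Require Import all_classical all_reals all_analysis.
From mathcomp Require Import measurable_realfun.

(* The excess risk of the noiseless average is bounded by uniform stability
   rather than by a Rademacher complexity. A gradient step on a convex
   beta-smooth loss with eta <= 2/beta, followed by the projection, is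
   nonexpansive, so exchanging the examples at positions s < t of the
   permutation moves w_t by at most 2 L eta. Hence, on average over the
   permutations, each of the t examples already seen by w_t contributes to the
   risk of w_t at most 2 L^2 eta more than the next example, and the regret
   bound of online gradient descent along the permutation gives the excess risk
   2 R^2 / (eta m) + 3/2 L^2 eta = 7/2 L R / sqrt m, where
   7/2 <= 1 + 2 sqrt 2. The noise adds L E||kappa||. With
   Z(a) = int exp(-a||x||) dx one has Z(b) = (a/b)^d Z(a), and integrating
   (1 + (a-b)||x||) exp(-a||x||) <= exp(-b||x||) and letting b tend to a yields
   E||kappa|| <= d/a for a = eps / (2 L eta). *)

Set Implicit Arguments.
Unset Strict Implicit.
Unset Printing Implicit Defensive.

Import Order.TTheory GRing.Theory Num.Theory.
Import numFieldNormedType.Exports.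

Local Open Scope classical_set_scope.
Local Open Scope ring_scope.

(** * Euclidean geometry *)

(** Replaces passages to the limit: the subdivision and shrinking arguments below are all run with
    an error of order [1 / n.+1]. The Archimedean property rules out [b < a]. *)
Lemma le_of_harmonic_error {R : realType} (a b c : R) :
  (forall n : nat, a <= b + c / n.+1%:R) -> a <= b.
Proof.
move=> abc; rewrite leNgt; apply/negP => ba.
have c0 : 0 < c.
  rewrite ltNge; apply/negP => c0; have := abc 0%N.
  by rewrite divr1; lra.
have := truncnS_gt (c / (a - b)).
set n := Num.truncn _ => cn.
have := abc n; rewrite -lerBlDl ler_pdivlMr// leNgt => /negP; apply.
by rewrite mulrC -ltr_pdivrMr// subr_gt0.
Qed.

Section euclidean_space.
Context {R : realType} {d : nat}.
Implicit Types (u v w z : 'rV[R]_d) (a b k : R).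

Lemma dotpC u v : dotp u v = dotp v u.
Proof. by apply: eq_bigr => i _; rewrite mulrC. Qed.

Lemma dotpDl u v w : dotp (u + v) w = dotp u w + dotp v w.
Proof. by rewrite -big_split/=; apply: eq_bigr => i _; rewrite mxE mulrDl. Qed.

Lemma dotpZl k u v : dotp (k *: u) v = k * dotp u v.
Proof. by rewrite big_distrr/=; apply: eq_bigr => i _; rewrite mxE mulrA. Qed.

Lemma dotpNl u v : dotp (- u) v = - dotp u v.
Proof. by rewrite -scaleN1r dotpZl mulN1r. Qed.

Lemma dotpDr u v w : dotp w (u + v) = dotp w u + dotp w v.
Proof. by rewrite dotpC dotpDl !(dotpC w). Qed.

Lemma dotpBl u v w : dotp (u - v) w = dotp u w - dotp v w.
Proof. by rewrite dotpDl dotpNl. Qed.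

Lemma dotpZr k u v : dotp u (k *: v) = k * dotp u v.
Proof. by rewrite dotpC dotpZl dotpC. Qed.

Lemma dotpNr u v : dotp u (- v) = - dotp u v.
Proof. by rewrite dotpC dotpNl dotpC. Qed.

Definition dotpE := (dotpDl, dotpDr, dotpNl, dotpNr, dotpZl, dotpZr).

Lemma dotp0l v : dotp 0 v = 0.
Proof. by rewrite -(scale0r 0) dotpZl mul0r. Qed.

Lemma dotp_suml (I : Type) (r : seq I) (F : I -> 'rV[R]_d) v :
  dotp (\sum_(i <- r) F i) v = \sum_(i <- r) dotp (F i) v.
Proof.
elim: r => [|i r ih]; first by rewrite !big_nil dotp0l.
by rewrite !big_cons dotpDl ih.
Qed.

Lemma dotp_ge0 u : 0 <= dotp u u.
Proof. by apply: sumr_ge0 => i _; rewrite -expr2 sqr_ge0. Qed.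

Lemma enorm_ge0 u : 0 <= enorm u.
Proof. exact: sqrtr_ge0. Qed.

Lemma sqr_enorm u : enorm u ^+ 2 = dotp u u.
Proof. by rewrite sqr_sqrtr// dotp_ge0. Qed.

Lemma enormZ k u : enorm (k *: u) = `|k| * enorm u.
Proof.
by rewrite /enorm !dotpE mulrA -expr2 sqrtrM ?sqr_ge0// sqrtr_sqr.
Qed.

Lemma enormN u : enorm (- u) = enorm u.
Proof. by rewrite -scaleN1r enormZ normrN1 mul1r. Qed.

Lemma enorm0 : enorm (0 : 'rV[R]_d) = 0.
Proof. by rewrite /enorm dotp0l sqrtr0. Qed.

Lemma enormB u v : enorm (u - v) = enorm (v - u).
Proof. by rewrite -opprB enormN. Qed.

Lemma sqr_enormB u v :
  enorm (u - v) ^+ 2 = enorm u ^+ 2 - 2 * dotp u v + enorm v ^+ 2.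
Proof. by rewrite !sqr_enorm !dotpE (dotpC v u); ring. Qed.

Lemma enorm_eq0 u : enorm u = 0 -> u = 0.
Proof.
move=> u0; have : dotp u u == 0 by rewrite -sqr_enorm u0 expr0n.
rewrite psumr_eq0 => [/allP h|i _]; last by rewrite -expr2 sqr_ge0.
apply/rowP => i; rewrite mxE; apply/eqP.
by have /= := h i (mem_index_enum _); rewrite mulf_eq0 orbb.
Qed.

(* With [a = ||u||] and [b = ||v||],
   [0 <= ||b u - a v||^2 = 2 a b (a b - <u, v>)]. *)
Lemma dotp_le u v : dotp u v <= enorm u * enorm v.
Proof.
have [/enorm_eq0 ->|u0] := eqVneq (enorm u) 0.
  by rewrite dotp0l enorm0 mul0r.
have [/enorm_eq0 ->|v0] := eqVneq (enorm v) 0.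
  by rewrite dotpC dotp0l enorm0 mulr0.
have up : 0 < enorm u by rewrite lt_neqAle eq_sym u0 enorm_ge0.
have vp : 0 < enorm v by rewrite lt_neqAle eq_sym v0 enorm_ge0.
have := sqr_ge0 (enorm (enorm v *: u - enorm u *: v)).
rewrite sqr_enormB !enormZ !dotpE !ger0_norm ?enorm_ge0//.
have -> : (enorm v * enorm u) ^+ 2 - 2 * (enorm v * (enorm u * dotp u v)) +
  (enorm u * enorm v) ^+ 2 =
  (2 * enorm u * enorm v) * (enorm u * enorm v - dotp u v) by ring.
by rewrite pmulr_rge0 ?subr_ge0// !mulr_gt0.
Qed.

Lemma enormD u v : enorm (u + v) <= enorm u + enorm v.
Proof.
rewrite -(ler_pXn2r (ltn0Sn 1)) ?nnegrE ?addr_ge0 ?enorm_ge0//.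
rewrite -{1}(opprK v) sqr_enormB dotpNr enormN sqrrD -mulr_natr.
by have := dotp_le u v; lra.
Qed.

Lemma normr_coord_le_enorm u i : `|u 0 i| <= enorm u.
Proof.
rewrite -sqrtr_sqr ler_wsqrtr// /dotp (bigD1 i)//= -expr2 lerDl.
by apply: sumr_ge0 => j _; rewrite -expr2 sqr_ge0.
Qed.

Lemma norm_le_enorm u : `|u| <= enorm u.
Proof.
have [->|u0] := eqVneq u 0; first by rewrite normr0 enorm_ge0.
have [|[i j] /= uE] := @mx_norm_neq0 _ _ _ u.
  by apply: contra_neq u0; exact: mx_norm_eq0.
by rewrite [leLHS]uE (ord1 i) normr_coord_le_enorm.
Qed.

End euclidean_space.

(** * Euclidean projection onto a compact convex set *)

Section projection.
Context {R : realType} {d : nat}.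
Variables (W : set 'rV[R]_d).
Hypothesis (W0 : W !=set0) (Wcl : closed W).
Hypothesis Wcvx : @convex_set R 'rV[R]_d W.
Variable rad : R.
Hypothesis Wrad : forall w, W w -> enorm w <= rad.

Lemma convex_set_segment u v (t : R) :
  W u -> W v -> 0 <= t -> t <= 1 -> W (u + t *: (v - u)).
Proof.
move=> Wu Wv t0 t1.
have /mem_set := Wu; have /mem_set := Wv.
move=> Wv' Wu'.
have h := Wcvx (@Itv01 R t t0 t1) Wv' Wu'.
move/set_mem : h.
rewrite /conv /= /unstable.onem.
congr W. by rewrite scalerBr scalerBl scale1r addrCA addrC -addrA (addrC (- _)).
Qed.

Lemma enorm_continuous : continuous (enorm : 'rV[R]_d -> R).
Proof.
have dotp_cont : continuous (fun u : 'rV[R]_d => dotp u u).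
  apply: continuous_big => [|i _ u]; first exact: add_continuous.
  have c := @coord_continuous R 1 d 0 i u.
  exact: (cvgM c c).
move=> u; apply: (continuous_comp (dotp_cont u)); exact: sqrt_continuous.
Qed.

(** Boundedness by [rad] makes the closed set [W] compact, so the distance to [v] attains its
    minimum on [W] and [xget] never returns its default value. *)
Lemma nearest_pointP v :
  W (nearest_point W v) /\
  forall z, W z -> enorm (v - nearest_point W v) <= enorm (v - z).
Proof.
rewrite /nearest_point; case: xgetP => [p _ //|] none; exfalso.
have Wcpt : compact W.
  apply: bounded_closed_compact => //.
  exists rad; split; first exact: num_real.
  move=> M radM w Ww.
  exact: le_trans (norm_le_enorm w) (le_trans (Wrad Ww) (ltW radM)).
have [|c cW cmin] :=
    @EVT_min_rV R d (fun z : 'rV[R]_d => enorm (v - z)) W W0 Wcpt.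
  apply: continuous_subspaceT => z.
  apply: continuous_comp; last exact: enorm_continuous.
  exact: (cvgB (cvg_cst v) (@cvg_id _ (nbhs z))).
apply: (none c); split; first exact: set_mem.
by move=> z /mem_set/cmin.
Qed.

Lemma nearest_point_in v : W (nearest_point W v).
Proof. by have [] := nearest_pointP v. Qed.

(** First-order optimality: comparing the projection [p] with the point at parameter [t] of the
    segment from [p] to [z] and expanding the square leaves an error [t / 2 * enorm (z - p) ^+ 2],
    with [t = 1 / n.+1]. *)
Lemma nearest_point_variational v z :
  W z -> dotp (v - nearest_point W v) (z - nearest_point W v) <= 0.
Proof.
have [Wp minp] := nearest_pointP v; set p := nearest_point W v in Wp minp *.
move=> Wz; apply: (@le_of_harmonic_error _ _ _ (enorm (z - p) ^+ 2 / 2)) => n.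
set t : R := n.+1%:R^-1.
have t0 : 0 < t by rewrite invr_gt0.
have t1 : t <= 1 by rewrite invf_le1// ler1n.
have := minp _ (convex_set_segment Wp Wz (ltW t0) t1).
rewrite -(ler_pXn2r (ltn0Sn 1)) ?nnegrE ?enorm_ge0//.
rewrite opprD addrA [leRHS]sqr_enormB dotpZr enormZ exprMn (ger0_norm (ltW t0)).
move=> h; have : t * (2 * dotp (v - p) (z - p)) <= t * (t * enorm (z - p) ^+ 2).
  by nra.
by rewrite ler_pM2l// => {}h; nra.
Qed.

(** Firm nonexpansiveness, obtained by adding the variational inequalities at [u] and [v]. This form
    is kept because the gradient step is later controlled only through its pairing with [p - q]. *)
Lemma sqr_dist_nearest_point_le u v :
  enorm (nearest_point W u - nearest_point W v) ^+ 2 <=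
  dotp (u - v) (nearest_point W u - nearest_point W v).
Proof.
have := nearest_point_variational u (nearest_point_in v).
have := nearest_point_variational v (nearest_point_in u).
set p := nearest_point W u; set q := nearest_point W v.
rewrite -(opprB p q) dotpNr oppr_le0 sqr_enorm.
have e : p - q = (u - v) - (u - p) + (v - q).
  by apply/rowP => i; rewrite !mxE; ring.
move=> h1 h2; rewrite {1}e dotpDl dotpBl -lerBrDr lerD2l.
by rewrite lerN2 (le_trans h1).
Qed.

Lemma nearest_point_nonexpansive u v :
  enorm (nearest_point W u - nearest_point W v) <= enorm (u - v).
Proof.
have := sqr_dist_nearest_point_le u v.
set p := nearest_point W u - nearest_point W v.
have [->|p0] := eqVneq (enorm p) 0; first by rewrite enorm_ge0.
move=> /le_trans/(_ (dotp_le _ _)); rewrite expr2 ler_pM2r//.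
by rewrite lt_neqAle eq_sym p0 enorm_ge0.
Qed.

Lemma nearest_point_id u : W u -> nearest_point W u = u.
Proof.
move=> Wu; have [_ /(_ _ Wu)] := nearest_pointP u.
rewrite subrr enorm0 => h; apply/esym/eqP; rewrite -subr_eq0; apply/eqP.
by apply: enorm_eq0; apply/le_anti; rewrite h enorm_ge0.
Qed.

(** * Nonexpansiveness of a projected gradient step on a smooth convex function *)

Section smooth_convex.
Variables (f : 'rV[R]_d -> R) (beta eta : R).
Hypotheses (fcvx : convex_in W f) (fsm : smooth_in W beta f).
Hypotheses (beta0 : 0 <= beta) (eta0 : 0 <= eta) (etabeta : eta * beta <= 2).
Local Notation g := (grad f).

(* Sums the gradient inequality along an equidistant subdivision of [u, v]. *)
Lemma descent_lemma u v : W u -> W v ->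
  f v <= f u + dotp (g u) (v - u) + beta / 2 * enorm (v - u) ^+ 2.
Proof.
move=> Wu Wv; set D := enorm (v - u) ^+ 2.
apply: (@le_of_harmonic_error _ _ _ (beta / 2 * D)) => n.
set N : R := n.+1%:R; have N0 : 0 < N by rewrite ltr0n.
pose y k := u + (k%:R / N) *: (v - u).
have Wy k : (k <= n.+1)%N -> W (y k).
  move=> kn; apply: convex_set_segment => //; first by rewrite divr_ge0.
  by rewrite ler_pdivrMr// mul1r ler_nat.
(* Convexity at the right end of the step from [y k] to [y k.+1], where the gradient is compared
   with [g u] by smoothness, costs [beta * D * k.+1 / N ^+ 2]. These costs add up to a triangular
   number; at [k = n.+1] the total exceeds [beta / 2 * D] by the harmonic error. *)
suff H k : (k <= n.+1)%N ->
    f (y k) <= f u + k%:R / N * dotp (g u) (v - u) +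
      beta * D * (k%:R * (k%:R + 1) / 2) / N ^+ 2.
  have := H n.+1 (leqnn _); rewrite /y -/N divff ?gt_eqF// scale1r.
  rewrite addrC subrK => /le_trans; apply.
  rewrite mul1r le_eqVlt; apply/orP; left; apply/eqP; field.
  by rewrite gt_eqF.
elim: k => [_|k ih kn].
  by rewrite /y !mul0r scale0r !addr0 mulr0 !mul0r addr0.
have yk : y k - y k.+1 = - (N^-1 *: (v - u)).
  by apply/rowP => i; rewrite !mxE -natr1; ring.
have yu : enorm (y k.+1 - u) = k.+1%:R / N * enorm (v - u).
  by rewrite /y addrC addKr enormZ ger0_norm// divr_ge0.
have h1 := fcvx (Wy k (ltnW kn)) (Wy _ kn).
rewrite yk dotpNr dotpZr in h1.
have h2 : dotp (g (y k.+1) - g u) (v - u) <= beta * (k.+1%:R / N) * D.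
  apply: (le_trans (dotp_le _ _)); rewrite /D expr2 mulrA -(mulrA beta) -yu.
  by rewrite ler_wpM2r ?enorm_ge0// fsm//; exact: Wy.
rewrite dotpDl dotpNl in h2.
have {}h2 : N^-1 * dotp (g (y k.+1)) (v - u) <=
    N^-1 * (dotp (g u) (v - u) + beta * (k.+1%:R / N) * D).
  by rewrite ler_pM2l ?invr_gt0// -lerBlDl.
have {}ih := ih (ltnW kn).
have -> : f u + k.+1%:R / N * dotp (g u) (v - u) +
   beta * D * (k.+1%:R * (k.+1%:R + 1) / 2) / N ^+ 2 =
   (f u + k%:R / N * dotp (g u) (v - u) +
     beta * D * (k%:R * (k%:R + 1) / 2) / N ^+ 2) +
   N^-1 * (dotp (g u) (v - u) + beta * (k.+1%:R / N) * D).
  by rewrite -natr1; field; rewrite gt_eqF.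
by rewrite (le_trans _ (lerD ih h2))// -lerBlDr.
Qed.

(* By polarization, the mixed second difference is the second difference along
   the diagonal X + Y, nonnegative by convexity, minus that along X - Y. *)
Lemma mixed_difference_le z X Y :
  W z -> W (z + X) -> W (z + Y) -> W (z + X + Y) -> enorm X = enorm Y ->
  dotp X Y - eta * (f (z + X + Y) - f (z + X) - f (z + Y) + f z) <=
    enorm X * enorm Y.
Proof.
move=> Wz WX WY WXY XY.
pose c := z + 2^-1 *: (X + Y).
have Wc : W c.
  have -> : c = z + 2^-1 *: (z + X + Y - z).
    by apply/rowP => i; rewrite !mxE; ring.
  by apply: convex_set_segment => //; lra.
have h1 := fcvx WXY Wc.
have h2 := fcvx Wz Wc.
have h3 := descent_lemma Wc WX.
have h4 := descent_lemma Wc WY.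
have e1 : z + X + Y - c = 2^-1 *: (X + Y).
  by apply/rowP => i; rewrite !mxE; field.
have e2 : z - c = - (2^-1 *: (X + Y)).
  by apply/rowP => i; rewrite !mxE; field.
have e3 : z + X - c = 2^-1 *: (X - Y).
  by apply/rowP => i; rewrite !mxE; field.
have e4 : z + Y - c = - (2^-1 *: (X - Y)).
  by apply/rowP => i; rewrite !mxE; field.
rewrite e1 in h1; rewrite e2 dotpNr in h2; rewrite e3 in h3.
rewrite e4 dotpNr enormN in h4.
have Q0 : 0 <= enorm (X - Y) ^+ 2 by rewrite sqr_ge0.
have Qe := sqr_enormB X Y; rewrite XY in Qe *.
rewrite !enormZ !exprMn ger0_norm ?invr_ge0// in h3 h4.
set M := f _ - f _ - f _ + f _.
(* The gradient terms at the midpoint [c] cancel between [h1] and [h2], and between [h3] and [h4].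
   As [X] and [Y] have equal norms, [enorm (X - Y) ^+ 2 / 2] is [enorm X * enorm Y - dotp X Y],
   which closes the proof once [eta * beta <= 2] is used. *)
have M0 : - M <= beta * enorm (X - Y) ^+ 2 / 4 by rewrite /M; lra.
have : eta * - M <= enorm (X - Y) ^+ 2 / 2.
  apply: (@le_trans _ _ (eta * (beta * enorm (X - Y) ^+ 2 / 4))).
    by rewrite ler_wpM2l.
  have := ler_wpM2r Q0 etabeta.
  by lra.
by rewrite expr2 in Qe *; lra.
Qed.

(** The strip between [[a, b]] and its translate by [Y] is cut into [n.+1] cells. The assumption on
    [enorm Y] makes every cell a rhombus, so [mixed_difference_le] applies to each, and the second
    differences telescope. *)
Lemma strip_difference_le a b Y (n : nat) :
  W a -> W b -> W (a + Y) -> W (b + Y) ->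
  enorm Y = enorm (b - a) / n.+1%:R ->
  dotp (b - a) Y - eta * (f (b + Y) - f b - f (a + Y) + f a) <=
    enorm (b - a) * enorm Y.
Proof.
move=> Wa Wb WaY WbY Yn; set X := b - a in Yn *.
set N : R := n.+1%:R in Yn; have N0 : 0 < N by rewrite ltr0n.
pose p k := a + (k%:R / N) *: X.
have kN k : (k <= n.+1)%N -> k%:R / N <= 1.
  by move=> kn; rewrite ler_pdivrMr// mul1r ler_nat.
have Wp k : (k <= n.+1)%N -> W (p k).
  by move=> kn; apply: convex_set_segment; rewrite ?divr_ge0 ?kN.
have WpY k : (k <= n.+1)%N -> W (p k + Y).
  move=> kn; have -> : p k + Y = (a + Y) + (k%:R / N) *: ((b + Y) - (a + Y)).
    by apply/rowP => i; rewrite !mxE; ring.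
  by apply: convex_set_segment; rewrite ?divr_ge0 ?kN.
have pN : p n.+1 = b.
  by rewrite /p -/N divff ?gt_eqF// scale1r addrC subrK.
suff H k : (k <= n.+1)%N -> k%:R / N * dotp X Y -
     eta * (f (p k + Y) - f (p k) - f (a + Y) + f a) <=
     k%:R / N * (enorm X * enorm Y).
  by have := H n.+1 (leqnn _); rewrite pN -/N divff ?gt_eqF// !mul1r.
elim: k => [_|k ih kn].
  have e : f (a + Y) - f a - f (a + Y) + f a = 0 by ring.
  by rewrite /p !mul0r scale0r addr0 e mulr0 subr0.
have pS : p k + N^-1 *: X = p k.+1.
  by apply/rowP => i; rewrite !mxE -natr1; ring.
have {}ih := ih (ltnW kn).
have := @mixed_difference_le (p k) (N^-1 *: X) Y.
rewrite pS enormZ dotpZl ger0_norm ?invr_ge0 ?(ltW N0)// => h.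
have {}h := h (Wp _ (ltnW kn)) (Wp _ kn) (WpY _ (ltnW kn)) (WpY _ kn).
have {h} := h ltac:(by rewrite Yn mulrC).
rewrite -natr1 !mulrDl.
set A := f (p k.+1 + Y); set B := f (p k.+1).
move: ih; move: (N^-1) (dotp X Y) (enorm X) (enorm Y) => c D nX nY.
by lra.
Qed.

(** The infinitesimal form of [strip_difference_le], with [Y = k *: y] and [k] tending to 0. The
    increment of [f] at [b] is bounded above by the descent lemma, the one at [a] below by
    convexity, and the inequality is divided by [k]. *)
Lemma gradient_difference_pairing_le a b y k0 :
  W a -> W b -> 0 < k0 -> W (a + k0 *: y) -> W (b + k0 *: y) ->
  dotp ((b - a) - eta *: (g b - g a)) y <= enorm (b - a) * enorm y.
Proof.
move=> Wa Wb k00 Way Wby.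
have [/enorm_eq0 ->|y0] := eqVneq (enorm y) 0.
  by rewrite dotpC dotp0l enorm0 mulr0.
have [/enorm_eq0/eqP|X0] := eqVneq (enorm (b - a)) 0.
  rewrite subr_eq0 => /eqP ->.
  by rewrite !subrr scaler0 subr0 dotp0l enorm0 mul0r.
have yp : 0 < enorm y by rewrite lt_neqAle eq_sym y0 enorm_ge0.
have Xp : 0 < enorm (b - a) by rewrite lt_neqAle eq_sym X0 enorm_ge0.
have := truncnS_gt (enorm (b - a) / (k0 * enorm y)).
set M := Num.truncn _; rewrite ltr_pdivrMr ?mulr_gt0// => hM.
apply: (@le_of_harmonic_error _ _ _ (enorm (b - a) * enorm y)) => n.
(* The factor [M.+1] ensures [k <= k0], so that the translates stay in [W]; the factor [n.+1] makes
   the remainder [k * enorm y ^+ 2] a harmonic error. The choice of [k] gives [k *: y] the length of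
   one piece of [[a, b]]. *)
pose N := (M.+1 * n.+1).-1.
have NE : N.+1 = (M.+1 * n.+1)%N by rewrite prednK.
pose k := enorm (b - a) / (N.+1%:R * enorm y).
have kp : 0 < k by rewrite divr_gt0// mulr_gt0.
have kk0 : k <= k0.
  rewrite ler_pdivrMr ?mulr_gt0// (le_trans (ltW hM))//.
  rewrite [leRHS]mulrCA ler_wpM2r ?mulr_ge0 ?(ltW k00) ?enorm_ge0// ler_nat NE.
  by rewrite leq_pmulr.
have Wk c : W c -> W (c + k0 *: y) -> W (c + k *: y).
  move=> Wc Wcy.
  have -> : c + k *: y = c + (k / k0) *: (c + k0 *: y - c).
    by apply/rowP => i; rewrite !mxE; field; rewrite gt_eqF.
  apply: convex_set_segment => //; first by rewrite divr_ge0 ?ltW.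
  by rewrite ler_pdivrMr// mul1r.
have kyn : enorm (k *: y) = enorm (b - a) / N.+1%:R.
  rewrite enormZ ger0_norm ?(ltW kp)// /k invfM mulrA divfK//.
have h1 := strip_difference_le Wa Wb (Wk _ Wa Way) (Wk _ Wb Wby) kyn.
have h2 := descent_lemma Wb (Wk _ Wb Wby).
have h3 := fcvx (Wk _ Wa Way) Wa.
have e c : c + k *: y - c = k *: y by rewrite addrC addKr.
rewrite dotpZr in h1; rewrite e dotpZr in h2; rewrite e dotpZr in h3.
rewrite enormZ ger0_norm ?(ltW kp)// in h1 h2.
have : k * dotp (b - a - eta *: (g b - g a)) y <=
    k * (enorm (b - a) * enorm y + k * enorm y ^+ 2).
  rewrite !(dotpDl, dotpNl, dotpZl).
  rewrite !(dotpDl, dotpNl) in h1.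
  set A := f _ - f _ - f _ + f _ in h1.
  have hA : eta * A <= eta * (k * dotp (g b) y - k * dotp (g a) y +
      beta / 2 * (k * enorm y) ^+ 2).
    rewrite ler_wpM2l// /A; lra.
  have : eta * (beta / 2 * (k * enorm y) ^+ 2) <= (k * enorm y) ^+ 2.
    by rewrite mulrA ler_piMl ?sqr_ge0// mulrA ler_pdivrMr// mul1r.
  by rewrite exprMn; lra.
rewrite ler_pM2l// => /le_trans; apply.
rewrite lerD2l /k expr2 mulrA.
have -> : enorm (b - a) / (N.+1%:R * enorm y) * enorm y =
   enorm (b - a) / N.+1%:R by rewrite invfM mulrA divfK.
rewrite mulrAC ler_wpM2l ?mulr_ge0 ?enorm_ge0// lef_pV2 ?posrE// ler_nat NE.
by rewrite leq_pmull.
Qed.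

(* W may have empty interior, and [grad f] is then only controlled in the
   directions of W: hence the pairing with [p - q]. Pulling a and b slightly
   towards the midpoint of p and q leaves room in this direction. *)
Lemma gradient_step_pairing_le a b p q : W a -> W b -> W p -> W q ->
  dotp ((a - b) - eta *: (g a - g b)) (p - q) <= enorm (a - b) * enorm (p - q).
Proof.
move=> Wa Wb Wp Wq; pose z := p + 2^-1 *: (q - p).
have Wz : W z by apply: convex_set_segment => //; lra.
set y := p - q.
(* The error constant accounts for replacing the gradients at the pulled points by those at [a] and
   [b], which smoothness allows at a cost proportional to [s]. *)
apply: (@le_of_harmonic_error _ _ _
  (eta * beta * (enorm (z - a) + enorm (z - b)) * enorm y)) => n.
set s : R := n.+1%:R^-1.
have s0 : 0 < s by rewrite invr_gt0.
have s1 : s <= 1 by rewrite invf_le1// ler1n.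
pose pull c := c + s *: (z - c).
have Wpull c : W c -> W (pull c).
  by move=> Wc; apply: convex_set_segment => //; exact: ltW.
(* Since [z + 2^-1 *: y = p], this translate lies on the segment from [c] to [p]. *)
have Wpully c : W c -> W (pull c + (s / 2) *: y).
  move=> Wc; have -> : pull c + (s / 2) *: y = c + s *: (p - c).
    by apply/rowP => i; rewrite !mxE; field.
  by apply: convex_set_segment => //; exact: ltW.
have h1 := gradient_difference_pairing_le (Wpull _ Wb) (Wpull _ Wa)
  (divr_gt0 s0 (ltr0n _ 2)) (Wpully _ Wb) (Wpully _ Wa).
have e1 : pull a - pull b = (1 - s) *: (a - b).
  by apply/rowP => i; rewrite !mxE; ring.
rewrite e1 enormZ ger0_norm ?subr_ge0// in h1.
have gpull c : W c -> enorm (g (pull c) - g c) <= beta * (s * enorm (z - c)).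
  move=> Wc; rewrite (le_trans (fsm (Wpull _ Wc) Wc))// ler_wpM2l//.
  by rewrite /pull addrC addKr enormZ (ger0_norm (ltW s0)).
have gpullC c : W c -> enorm (g c - g (pull c)) <= beta * (s * enorm (z - c)).
  by move=> Wc; rewrite enormB gpull.
have h2 := le_trans (dotp_le (g (pull a) - g a) y)
  (ler_wpM2r (enorm_ge0 y) (gpull _ Wa)).
have h3 := le_trans (dotp_le (g b - g (pull b)) y)
  (ler_wpM2r (enorm_ge0 y) (gpullC _ Wb)).
have h4 := ler_wpM2l (ltW s0) (dotp_le (a - b) y).
have h23 := ler_wpM2l eta0 (lerD h2 h3).
rewrite dotpBl !dotpZl (dotpBl (g _)) in h1.
rewrite (dotpBl (g (pull a))) (dotpBl (g b)) in h23.
rewrite dotpBl dotpZl (dotpBl (g a)).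
move: h1 h23 h4; move: (dotp (a - b) y) (dotp (g a) y) (dotp (g b) y)
  (dotp (g (pull a)) y) (dotp (g (pull b)) y) (enorm y) (enorm (a - b))
  (enorm (z - a)) (enorm (z - b)) => *.
by lra.
Qed.

(** Firm nonexpansiveness reduces the claim to the pairing of the unprojected difference with
    [p - q], a difference of two points of [W]; it remains to divide by [enorm (p - q)]. *)
Lemma gradient_step_nonexpansive a b : W a -> W b ->
  enorm (nearest_point W (a - eta *: g a) - nearest_point W (b - eta *: g b)) <=
  enorm (a - b).
Proof.
move=> Wa Wb; set u := a - eta *: g a; set v := b - eta *: g b.
have uv : u - v = (a - b) - eta *: (g a - g b).
  by apply/rowP => i; rewrite !mxE; ring.
have := sqr_dist_nearest_point_le u v.
have := nearest_point_in v; have := nearest_point_in u.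
move: (nearest_point W u) (nearest_point W v) => p q Wp Wq.
have [->|pq0] := eqVneq (enorm (p - q)) 0; first by rewrite enorm_ge0.
rewrite uv => /le_trans/(_ (gradient_step_pairing_le Wa Wb Wp Wq)).
by rewrite expr2 ler_pM2r// lt_neqAle eq_sym pq0 enorm_ge0.
Qed.

End smooth_convex.

End projection.

(** * Projected gradient descent *)

Section gradient_bound.
Context {R : realType} {d : nat}.
Variables (f : 'rV[R]_d -> R) (L : R).
Hypothesis fdiff : forall w, differentiable f w.
Hypothesis L0 : 0 <= L.
Hypothesis flip : lipschitz_in setT L f.

Lemma dotp_grad w v : dotp (grad f w) v = 'D_v f w.
Proof.
rewrite deriveE// [in RHS](row_sum_delta v) linear_sum/=.
by apply: eq_bigr => i _; rewrite mxE linearZ/= deriveE// mulrC.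
Qed.

Lemma derive_lipschitz_le w v : 'D_v f w <= L * enorm v.
Proof.
have /cvg_ex[/= D fD] : derivable f w v by exact: diff_derivable.
apply: limr_le; first by apply/cvg_ex; exists D.
near=> h.
have h0 : h != 0 by near: h; exact: nbhs_dnbhs_neq.
apply: (le_trans (ler_norm _)); rewrite normrZ normfV.
rewrite ler_pdivrMl ?normr_gt0//.
apply: (le_trans (flip _ _)) => //.
by rewrite addrK enormZ mulrCA.
Unshelve. all: by end_near. Qed.

(** The derivative in the direction of the gradient itself is the squared norm of the gradient. *)
Lemma enorm_grad_le w : enorm (grad f w) <= L.
Proof.
have := derive_lipschitz_le w (grad f w).
rewrite -dotp_grad -sqr_enorm expr2.
have [->//|g0] := eqVneq (enorm (grad f w)) 0.
by rewrite ler_pM2r// lt_neqAle eq_sym g0 enorm_ge0.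
Qed.

End gradient_bound.

(** * Averages in convex sets and Jensen's inequality *)

Section convex_average.
Context {R : realType} {d : nat}.
Variables (W : set 'rV[R]_d).
Hypothesis Wcvx : @convex_set R 'rV[R]_d W.

Lemma convex_set_average (m : nat) (w : nat -> 'rV[R]_d) :
  (0 < m)%N -> (forall t, W (w t)) -> W (m%:R^-1 *: \sum_(t < m) w t).
Proof.
case: m => // n _ Ww; elim: n => [|n ih].
  by rewrite invr1 scale1r big_ord_recl big_ord0 addr0.
rewrite big_ord_recr/=; set S := \sum_(i < _) _ in ih *.
have -> : n.+2%:R^-1 *: (S + w n.+1) =
    n.+1%:R^-1 *: S + n.+2%:R^-1 *: (w n.+1 - n.+1%:R^-1 *: S).
  have := ltr0Sn R n; rewrite -(natr1 n.+1); move: n.+1%:R => a a0.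
  apply/rowP => i; rewrite !mxE; field.
  by rewrite !gt_eqF ?addr_gt0.
apply: convex_set_segment => //.
by rewrite invf_le1// ler1n.
Qed.

(** The gradient inequalities at the average are summed; their linear terms cancel. *)
Lemma jensen_average (m : nat) (w : nat -> 'rV[R]_d) (f : 'rV[R]_d -> R) :
  (0 < m)%N -> (forall t, W (w t)) -> convex_in W f ->
  m%:R * f (m%:R^-1 *: \sum_(t < m) w t) <= \sum_(t < m) f (w t).
Proof.
move=> m0 Ww fcvx; set v := _ *: _.
have Wv : W v by exact: convex_set_average.
have : \sum_(t < m) (f v + dotp (grad f v) (w t - v)) <= \sum_(t < m) f (w t).
  by apply: ler_sum => t _; exact: fcvx.
rewrite big_split/= sumr_const card_ord mulr_natl.
have -> : \sum_(t < m) dotp (grad f v) (w t - v) = 0.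
  under eq_bigr do rewrite dotpC.
  rewrite -dotp_suml sumrB sumr_const card_ord -scaler_nat /v scalerA.
  by rewrite divff ?pnatr_eq0 -?lt0n// scale1r subrr dotp0l.
by rewrite addr0.
Qed.

End convex_average.

(** * Regret, stability and excess risk of SGD along a permutation *)

Section projected_sgd.
Context {R : realType} {d m : nat}.
Variables (W : set 'rV[R]_d).
Hypothesis (W0 : W !=set0) (Wcl : closed W).
Hypothesis Wcvx : @convex_set R 'rV[R]_d W.
Variable rad : R.
Hypothesis Wrad : forall w, W w -> enorm w <= rad.
Variables (l : 'I_m -> 'rV[R]_d -> R) (L beta eta : R).
Hypotheses (L0 : 0 <= L) (beta0 : 0 <= beta) (eta0 : 0 < eta).
Hypothesis etabeta : eta * beta <= 2.
Hypothesis ldiff : forall i w, differentiable (l i) w.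
Hypothesis lcvx : forall i, convex_in W (l i).
Hypothesis llip : forall i, lipschitz_in setT L (l i).
Hypothesis lsm : forall i, smooth_in W beta (l i).

Let nearestW v : W (nearest_point W v).
Proof. exact: (nearest_point_in W0 Wcl Wrad v). Qed.

Lemma sgd_iterate_in w1 s : W w1 -> W (sgd_iterate W eta w1 s).
Proof.
by move=> Ww1; elim/last_ind: s => // s f _; rewrite /sgd_iterate foldl_rcons.
Qed.

(** The potential is the squared distance to [u]. Since [u] is its own projection, projecting does
    not increase this distance, so each step lowers it by [2 * eta] times the regret of that step,
    up to [(eta * L) ^+ 2]; the potentials telescope. *)
Lemma sgd_regret (F : 'I_m -> 'I_m) (w : nat -> 'rV[R]_d) u :
  W (w 0%N) -> W u ->
  (forall t : 'I_m,
     w t.+1 = nearest_point W (w t - eta *: grad (l (F t)) (w t))) ->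
  2 * eta * \sum_(t < m) (l (F t) (w t) - l (F t) u) <=
    enorm (w 0%N - u) ^+ 2 + m%:R * (eta * L) ^+ 2.
Proof.
move=> Ww0 Wu wS.
have Ww (t : 'I_m) : W (w t).
  case: t => -[//|t] tm /=.
  by rewrite (wS (Ordinal (ltnW tm))).
have step (t : 'I_m) : 2 * eta * (l (F t) (w t) - l (F t) u) <=
    (enorm (w t - u) ^+ 2 - enorm (w t.+1 - u) ^+ 2) + (eta * L) ^+ 2.
  have h1 := lcvx (F t) Wu (Ww t).
  have h2 := nearest_point_nonexpansive W0 Wcl Wcvx Wrad
    (w t - eta *: grad (l (F t)) (w t)) u.
  rewrite -wS (nearest_point_id W0 Wcl Wrad)// in h2.
  have g0 := enorm_grad_le (ldiff (F t)) L0 (llip (F t)) (w t).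
  set g := grad (l (F t)) (w t) in h1 h2 g0.
  have {}g0 : (eta * enorm g) ^+ 2 <= (eta * L) ^+ 2.
    by rewrite ler_pXn2r ?nnegrE ?mulr_ge0 ?enorm_ge0 ?(ltW eta0)// ler_pM2l.
  have {}h2 : enorm (w t.+1 - u) ^+ 2 <= enorm (w t - u - eta *: g) ^+ 2.
    by rewrite ler_pXn2r ?nnegrE ?enorm_ge0// addrAC.
  rewrite [leRHS]sqr_enormB dotpZr enormZ ger0_norm ?(ltW eta0)// in h2.
  have h3 : dotp g (u - w t) = - dotp (w t - u) g.
    by rewrite -opprB dotpNr dotpC.
  rewrite h3 in h1.
  have := ler_wpM2l (ltW eta0) h1.
  by move: h2 g0; move: (dotp _ _) (enorm _ ^+ 2) (enorm _ ^+ 2) => *; lra.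
have : \sum_(t < m) (2 * eta * (l (F t) (w t) - l (F t) u)) <=
    \sum_(t < m)
      (enorm (w t - u) ^+ 2 - enorm (w t.+1 - u) ^+ 2 + (eta * L) ^+ 2).
  by apply: ler_sum => t _.
rewrite -mulr_sumr [X in _ <= X -> _]big_split/= sumr_const card_ord.
rewrite -(mulr_natl (_ ^+ 2)) => /le_trans; apply.
rewrite lerD2r -(big_mkord xpredT
  (fun t => enorm (w t - u) ^+ 2 - enorm (w t.+1 - u) ^+ 2)).
under eq_bigr do rewrite -opprB.
by rewrite sumrN telescope_sumr// opprB lerBlDr lerDl sqr_ge0.
Qed.

(** A step on a common loss does not increase the distance. A step on two different losses adds at
    most the lengths of both gradient moves, that is [2 * L * eta]. *)
Lemma sgd_stability a b (e : seq 'I_m) (h1 h2 : 'I_m -> 'I_m) : W a -> W b ->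
  enorm (sgd_iterate W eta a [seq l (h1 i) | i <- e] -
         sgd_iterate W eta b [seq l (h2 i) | i <- e]) <=
  enorm (a - b) + 2 * L * eta * (count (fun i => h1 i != h2 i) e)%:R.
Proof.
elim: e a b => [|i e ih] a b Wa Wb /=; first by rewrite mulr0 addr0.
apply: (le_trans (ih _ _ _ _)) => //.
rewrite natrD mulrDr addrA lerD2r.
have [<-|h12] /= := eqVneq (h1 i) (h2 i).
  rewrite mulr0 addr0.
  exact: (gradient_step_nonexpansive W0 Wcl Wcvx Wrad (lcvx (h1 i))
    (lsm (h1 i)) beta0 (ltW eta0) etabeta).
rewrite mulr1 (le_trans (nearest_point_nonexpansive W0 Wcl Wcvx Wrad _ _))//.
have -> : a - eta *: grad (l (h1 i)) a - (b - eta *: grad (l (h2 i)) b) =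
    (a - b) + (eta *: grad (l (h2 i)) b - eta *: grad (l (h1 i)) a).
  by apply/rowP => j; rewrite !mxE; ring.
rewrite (le_trans (enormD _ _))// lerD2l (le_trans (enormD _ _))//.
rewrite enormN !enormZ (ger0_norm (ltW eta0)).
have := enorm_grad_le (ldiff (h1 i)) L0 (llip (h1 i)) a.
have := enorm_grad_le (ldiff (h2 i)) L0 (llip (h2 i)) b.
rewrite -(ler_pM2l eta0) => g1; rewrite -(ler_pM2l eta0) => g2.
by lra.
Qed.

Variable w1 : 'rV[R]_d.
Hypothesis Ww1 : W w1.

Let w (tau : 'S_m) (t : nat) :=
  sgd_iterate W eta w1 (take t [seq l (tau i) | i <- enum 'I_m]).

(* Composing with [tperm s t] exchanges the losses at positions s and t, whereas
   w_t depends on the positions before t only. *)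
Lemma sgd_iterate_tperm (tau : 'S_m) (s t : 'I_m) :
  enorm (w (tperm s t * tau)%g t - w tau t) <= 2 * L * eta * (s < t)%:R.
Proof.
have e (h : 'I_m -> 'I_m) : take t [seq l (h i) | i <- enum 'I_m] =
    [seq l (h i) | i <- take t (enum 'I_m)] by rewrite map_take.
rewrite /w !e; apply: (le_trans (sgd_stability _ _ _ Ww1 Ww1)).
rewrite subrr enorm0 add0r ler_wpM2l ?mulr_ge0 ?(ltW eta0)//.
have mem_take i : (i \in take t (enum 'I_m)) = (i < t)%N.
  by rewrite in_take ?mem_enum// index_enum_ord.
rewrite -mem_take -(count_uniq_mem s (take_uniq _ (enum_uniq _))) ler_nat.
rewrite -!size_filter.
(* Among the positions before [t], the transposition can only move [s]. *)
apply: uniq_leq_size => [|i].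
  exact/filter_uniq/take_uniq/enum_uniq.
rewrite !mem_filter mem_take permM /= => /andP[+ it]; rewrite it andbT.
by case: tpermP it => [->|->|]; rewrite ?eqxx ?ltnn.
Qed.

(** Precomposing the permutations with [tperm s t] turns the loss at position [s] into the loss at
    position [t]. By the Lipschitz bound the change of the iterate costs [2 * L ^+ 2 * eta] when
    [s < t] and nothing otherwise, and there are [t] such positions [s]. *)
Lemma sum_risk_iterate_le (t : 'I_m) :
  \sum_(tau : 'S_m) \sum_(i < m) l i (w tau t) <=
  m%:R * \sum_(tau : 'S_m) l (tau t) (w tau t) +
    #|{: 'S_m}|%:R * (2 * L ^+ 2 * eta * t%:R).
Proof.
have swap (s : 'I_m) : \sum_(tau : 'S_m) l (tau s) (w tau t) <=
    \sum_(tau : 'S_m) l (tau t) (w tau t) +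
    #|{: 'S_m}|%:R * (2 * L ^+ 2 * eta * (s < t)%:R).
  rewrite (reindex_inj (mulgI (tperm s t)))/= mulr_natl -sumr_const.
  rewrite -big_split/=.
  apply: ler_sum => tau _; rewrite permM tpermL.
  rewrite -lerBlDl (le_trans (ler_norm _))//.
  apply: (le_trans (llip _ _ _)) => //.
  apply: (le_trans (ler_wpM2l L0 (sgd_iterate_tperm tau s t))).
  by rewrite le_eqVlt; apply/orP; left; apply/eqP; ring.
under eq_bigr => tau _ do rewrite (reindex_inj (@perm_inj _ tau)).
rewrite exchange_big/= (le_trans (ler_sum _ (fun s _ => swap s)))//.
rewrite big_split/= sumr_const card_ord -[_ *+ m]mulr_natl lerD2l.
rewrite -mulr_sumr -mulr_sumr.
have -> // : \sum_(s < m) (s < t)%:R = t%:R :> R.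
rewrite -natr_sum; congr (_%:R).
rewrite -[RHS]card_ord -sum1_card.
rewrite (big_ord_widen m (fun=> 1%N)) ?(ltnW (ltn_ord t))//.
by rewrite [RHS]big_mkcond; apply: eq_bigr => s _; case: ltnP.
Qed.

(** Jensen passes from the average to the iterates, [sum_risk_iterate_le] from the risk to the next
    loss, and [sgd_regret] bounds the latter. Regret contributes [2 * rad ^+ 2 / (eta * m) + L ^+ 2
    * eta / 2] and stability [L ^+ 2 * eta]. *)
Lemma sum_excess_risk_le u : (0 < m)%N -> W u ->
  (\sum_(tau : 'S_m)
     (empirical_risk l (sgd_average W eta w1 l tau) - empirical_risk l u)) <=
  #|{: 'S_m}|%:R * (2 * rad ^+ 2 / (eta * m%:R) + 3 / 2 * L ^+ 2 * eta).
Proof.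
move=> m0 Wu; set K : R := #|_|%:R.
pose U := \sum_(i < m) l i u.
pose S (tau : 'S_m) := \sum_(i < m) l i (sgd_average W eta w1 l tau).
have M0 : 0 < m%:R :> R by rewrite ltr0n.
(* The regret bound, with the initial distance to [u] at most [2 * rad]. *)
pose B := (4 * rad ^+ 2 + m%:R * (eta * L) ^+ 2) / (2 * eta).
(* Iterates are counted from 0. The last [t] yields an iterate outside the average, which enters
   only the telescoping sum of the regret. *)
have wS (tau : 'S_m) (t : 'I_m) :
    w tau t.+1 = nearest_point W (w tau t - eta *: grad (l (tau t)) (w tau t)).
  rewrite /w (take_nth (l (tau t))); last by rewrite size_map size_enum_ord.
  rewrite /sgd_iterate foldl_rcons (nth_map t); last by rewrite size_enum_ord.
  by rewrite nth_ord_enum.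
have regret (tau : 'S_m) : \sum_(t < m) l (tau t) (w tau t) <= U + B.
  have Ww0 : W (w tau 0%N) by rewrite /w take0.
  have := @sgd_regret tau _ _ Ww0 Wu (wS tau).
  rewrite sumrB (_ : \sum_(i < m) l (tau i) u = U); last first.
    by rewrite /U [RHS](reindex_inj (@perm_inj _ tau)).
  have : enorm (w tau 0%N - u) ^+ 2 <= 4 * rad ^+ 2.
    rewrite (_ : 4 * _ = (rad + rad) ^+ 2); last by ring.
    rewrite ler_pXn2r ?nnegrE ?enorm_ge0//; last first.
      by rewrite addr_ge0// (le_trans (enorm_ge0 u) (Wrad Wu)).
    by rewrite (le_trans (enormD _ _))// enormN lerD// Wrad.
  move=> h1 h2; rewrite -lerBlDl /B ler_pdivlMr ?mulr_gt0//.
  by rewrite mulrC (le_trans h2)// lerD2r.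
have jensen (tau : 'S_m) :
    m%:R * S tau <= \sum_(t < m) \sum_(i < m) l i (w tau t).
  rewrite exchange_big/= /S mulr_sumr; apply: ler_sum => i _.
  by apply: (jensen_average Wcvx) => // t; exact: sgd_iterate_in.
have sum_t : \sum_(t < m) t%:R <= m%:R ^+ 2 / 2 :> R.
  elim: (m) => [|n ih]; first by rewrite big_ord0 divr_ge0.
  by rewrite big_ord_recr/= -natr1; have := ler0n R n; lra.
have : \sum_(tau : 'S_m) m%:R * S tau <=
    m%:R * (K * (U + B)) + K * (2 * L ^+ 2 * eta * (m%:R ^+ 2 / 2)).
  apply: (le_trans (ler_sum _ (fun tau _ => jensen tau))).
  rewrite exchange_big/=.
  rewrite (le_trans (ler_sum _ (fun t _ => sum_risk_iterate_le t)))//.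
  rewrite big_split/= -!mulr_sumr; apply: lerD; last first.
    by rewrite ler_wpM2l ?ler0n// ler_wpM2l// !mulr_ge0 ?sqr_ge0 ?(ltW eta0).
  rewrite ler_wpM2l ?(ltW M0)// exchange_big/=.
  rewrite (le_trans (ler_sum _ (fun tau _ => regret tau)))//.
  by rewrite sumr_const mulr_natl.
rewrite -mulr_sumr => h.
have -> : \sum_(tau : 'S_m) (empirical_risk l (sgd_average W eta w1 l tau)
    - empirical_risk l u) = m%:R^-1 * (\sum_tau S tau - K * U).
  rewrite sumrB sumr_const /empirical_risk -mulr_sumr -mulr_natl -/K -/U.
  by rewrite mulrBr; congr (_ - _); ring.
rewrite ler_pdivrMl//.
have {}h : \sum_tau S tau <= K * (U + B) + K * (L ^+ 2 * eta * m%:R).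
  rewrite -(ler_pM2l M0) (le_trans h)// le_eqVlt; apply/orP; left; apply/eqP.
  by field.
have -> : m%:R * (K * (2 * rad ^+ 2 / (eta * m%:R) + 3 / 2 * L ^+ 2 * eta)) =
    K * B + K * (L ^+ 2 * eta * m%:R).
  by rewrite /B; field; rewrite !gt_eqF.
by rewrite lerBlDr (le_trans h)// mulrDr; lra.
Qed.

End projected_sgd.

(** * Integration and the noise *)

(** The negative part of [f] only lowers its integral, and the integral of the positive part is a
    supremum over simple functions, each of which lies below [h] as well. The excess risk is thus
    compared pointwise, without a measurability proof. *)
Lemma integral_le_ge0 {d} {T : measurableType d} {R : realType}
    (mu : {measure set T -> \bar R}) (f h : T -> \bar R) :
  (forall x, 0 <= h x)%E -> (forall x, f x <= h x)%E ->
  (\int[mu]_x f x <= \int[mu]_x h x)%E.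
Proof.
move=> h0 fh; rewrite integralE.
apply: (@le_trans _ _ (\int[mu]_x (f^\+ x)))%E.
  by rewrite geeDl// oppe_le0 integral_ge0.
rewrite ge0_integralTE// ge0_integralTE//; apply: le_ereal_sup => _ [g gf <-].
exists g => // x; apply: (le_trans (gf x)).
by rewrite funeposE ge_max fh h0.
Qed.

(** * Integration against a measure with a density *)

Section density.
Local Open Scope ereal_scope.
Context {d} {T : measurableType d} {R : realType}.
Variables (mu nu : {measure set T -> \bar R}) (p : T -> R).
Hypotheses (mp : measurable_fun setT p) (p0 : forall x, (0 <= p x)%R).
Hypothesis nuE : forall A, measurable A -> nu A = \int[mu]_(x in A) (p x)%:E.

Let mEp : measurable_fun setT (EFin \o p).
Proof. exact/measurable_EFinP. Qed.

Import HBNNSimple.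

Let nnsfun_integral_density (h : {nnsfun T >-> R}) :
  \int[nu]_x (h x)%:E = \int[mu]_x ((h x)%:E * (p x)%:E).
Proof.
have mind r :
    measurable_fun [set: T] (fun x => (r * \1_(h @^-1` [set r]) x)%:E).
  by apply: (measurable_comp measurableT) => //; exact: measurable_funM.
transitivity (\int[nu]_x
   (\sum_(y \in range h) (y * \1_(h @^-1` [set y]) x)%:E)).
  by apply: eq_integral => t _; rewrite /= fimfunE -fsumEFin.
rewrite ge0_integral_fsum//; last by move=> m y Ey; exact: nnfun_muleindic_ge0.
transitivity (\int[mu]_x (\sum_(y \in range h)
    (y * \1_(h @^-1` [set y]) x)%:E * (p x)%:E)); last first.
  apply: eq_integral => x _; rewrite -ge0_mule_fsuml => [|y].
    by rewrite fsumEFin// -(fimfunE _ x).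
  exact: nnfun_muleindic_ge0.
rewrite ge0_integral_fsum//; last 2 first.
  - by move=> y; apply: emeasurable_funM.
  - move=> m y Ey; apply: mule_ge0; last by rewrite lee_fin.
    exact: nnfun_muleindic_ge0.
apply: eq_fsbigr => r rh.
under eq_integral do rewrite EFinM.
rewrite integralZl_indic_nnsfun//.
under [RHS]eq_integral do rewrite EFinM -muleA.
rewrite ge0_integralZl//.
- rewrite integral_indic// setIT nuE//.
  under [in RHS]eq_integral do rewrite muleC.
  rewrite [in RHS](eq_integral ((EFin \o p) \_ (h @^-1` [set r]))); last first.
    by move=> x xE; rewrite epatch_indic.
  by rewrite -integral_mkcond.
- by apply: emeasurable_funM => //; exact/measurable_EFinP.
- by move=> t Et; rewrite mule_ge0 ?lee_fin.
- by move: rh; rewrite inE => -[t _ <-]; rewrite lee_fin.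
Qed.

(** Simple functions reduce to [nuE] on their level sets; monotone convergence on both sides then
    gives the general case. *)
Lemma ge0_integral_density (f : T -> \bar R) :
  measurable_fun setT f -> (forall x, 0 <= f x) ->
  \int[nu]_x f x = \int[mu]_x (f x * (p x)%:E).
Proof.
move=> mf f0; pose h := nnsfun_approx measurableT mf.
have hf x : (h n x)%:E @[n --> \oo] --> f x.
  by apply: cvg_nnsfun_approx => // *; exact: f0.
transitivity (limn (fun n => \int[nu]_x (h n x)%:E)).
  rewrite -monotone_convergence//.
  - by apply: eq_integral => x _; exact/esym/cvg_lim.
  - by move=> n; exact/measurable_EFinP.
  - by move=> n x _; rewrite lee_fin.
  - by move=> x _ m n mn; rewrite lee_fin; exact/lefP/nd_nnsfun_approx.
transitivity (limn (fun n => \int[mu]_x ((h n x)%:E * (p x)%:E))).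
  by congr (limn _); apply/funext => n; exact: nnsfun_integral_density.
rewrite -monotone_convergence//.
- apply: eq_integral => x _; apply/cvg_lim => //.
  exact: (cvgeZr _ (hf x)).
- by move=> n; apply: emeasurable_funM => //; exact/measurable_EFinP.
- by move=> n x _; rewrite mule_ge0// lee_fin.
- move=> x _ m n mn; rewrite lee_wpmul2r ?lee_fin//.
  exact/lefP/nd_nnsfun_approx.
Qed.

End density.

(** * Lebesgue integrals under dilation *)

Section lebesgue_scaling.
Context {R : realType}.
Local Open Scope ereal_scope.

(** By uniqueness of Lebesgue measure, it suffices to compare [k] times the image measure with it on
    half-open intervals. *)
Lemma lebesgue_measure_scale (k : R) (A : set (measurableTypeR R)) :
  (0 < k)%R -> measurable A ->
  pushforward (@lebesgue_measure R) ( *%R k : _ -> measurableTypeR R) A =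
  k^-1%:E * lebesgue_measure A.
Proof.
move=> k0 mA.
suff -> : lebesgue_measure A = k%:E *
    pushforward (@lebesgue_measure R) ( *%R k : _ -> measurableTypeR R) A.
  by rewrite muleA -EFinM mulVf ?gt_eqF// mul1e.
apply: (@lebesgue_measure_unique R (mscale (NngNum (ltW k0))
  (pushforward (@lebesgue_measure R)
    ( *%R k : measurableTypeR R -> measurableTypeR R)))) => //.
move=> _ [[a b] _ <-].
transitivity (k%:E * lebesgue_measure `](a / k)%R, (b / k)%R]%classic);
  last first.
  congr (_ * lebesgue_measure _); apply/seteqP.
  by split=> x /=; rewrite !in_itv/= ltr_pdivrMr// ler_pdivlMr// (mulrC x).
rewrite !lebesgue_measure_itv/= !lte_fin ltr_pM2r ?invr_gt0//.
case: ifPn => ab; last by rewrite mule0.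
by rewrite -!EFinB -EFinM; congr (_%:E); field; rewrite gt_eqF.
Qed.

Lemma ge0_integral_lebesgue_scale (k : R) (f : R -> \bar R) : (0 < k)%R ->
  measurable_fun setT f -> (forall x, 0 <= f x) ->
  \int[lebesgue_measure]_x f (k * x)%R = k^-1%:E * \int[lebesgue_measure]_x f x.
Proof.
move=> k0 mf f0.
have ik0 : (0 <= k^-1)%R by rewrite invr_ge0 ltW.
transitivity (\int[pushforward (@lebesgue_measure R)
    ( *%R k : _ -> measurableTypeR R)]_x f x).
  by rewrite ge0_integral_pushforward//; exact: mulrl_measurable.
transitivity (\int[mscale (NngNum ik0) (@lebesgue_measure R)]_x f x).
  apply: eq_measure_integral => B mB _.
  exact: lebesgue_measure_scale.
by rewrite ge0_integral_mscale.
Qed.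

Definition scale_tuple (n : nat) (k : R) (t : n.-tuple R) : n.-tuple R :=
  [tuple of map ( *%R k) t].

Lemma measurable_scale_tuple n k : measurable_fun setT (@scale_tuple n k).
Proof.
apply/measurable_fun_tnthP => i.
rewrite (_ : _ \o _ = fun t => (k * tnth t i)%R).
  apply: measurable_funM => //; exact: measurable_tnth.
by apply/funext => t /=; rewrite tnth_map.
Qed.

Lemma ge0_integral_lebesgue_tupleS n (f : n.+1.-tuple R -> \bar R) :
  measurable_fun setT f -> (forall x, 0 <= f x) ->
  \int[lebesgue_tuple n.+1]_t f t =
  \int[lebesgue_measure]_x \int[lebesgue_tuple n]_t f [tuple of x :: t].
Proof.
move=> mf f0.
have mc : measurable_fun setT
    (fun xt : measurableTypeR R * n.-tuple R => [tuple of xt.1 :: xt.2]).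
  exact: measurable_cons.
rewrite /= ge0_integral_pushforward// fubini_tonelli1//.
- exact: (measurableT_comp mf).
- by move=> x /=.
Qed.

Lemma measurable_integral_lebesgue_tuple n (f : n.+1.-tuple R -> \bar R) :
  measurable_fun setT f -> (forall x, 0 <= f x) ->
  measurable_fun [set: R]
    (fun x => \int[lebesgue_tuple n]_t f [tuple of x :: t]).
Proof.
move=> mf f0.
apply: (measurable_fun_fubini_tonelli_F
  (fun xt : measurableTypeR R * n.-tuple R => f [tuple of xt.1 :: xt.2])) => //.
by apply: (measurableT_comp mf); exact: measurable_cons.
Qed.

(** Tonelli splits off the first coordinate, and each coordinate contributes a factor [k^-1]. *)
Lemma ge0_integral_lebesgue_tuple_scale n (k : R) (f : n.-tuple R -> \bar R) :
  (0 < k)%R -> measurable_fun setT f -> (forall x, 0 <= f x) ->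
  \int[lebesgue_tuple n]_t f (scale_tuple k t) =
  (k ^- n)%:E * \int[lebesgue_tuple n]_t f t.
Proof.
move=> k0; elim: n f => [|n ih] f mf f0.
  rewrite expr0 invr1 mul1e; apply: eq_integral => t _.
  by congr f; rewrite [LHS]tuple0 [RHS]tuple0.
rewrite !ge0_integral_lebesgue_tupleS//; last first.
  by apply: (measurableT_comp mf); exact: measurable_scale_tuple.
pose G x := \int[lebesgue_tuple n]_t f [tuple of x :: t].
have G0 x : 0 <= G x by apply: integral_ge0.
have mG : measurable_fun setT G by exact: measurable_integral_lebesgue_tuple.
have kn0 : 0 <= (k ^- n)%:E by rewrite lee_fin invr_ge0 exprn_ge0// ltW.
transitivity (\int[lebesgue_measure]_x ((k ^- n)%:E * G (k * x)%R)).
  apply: eq_integral => x _; rewrite -ih//; last first.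
    by apply: (measurableT_comp mf); exact: measurable_cons.
  by apply: eq_integral => t _; congr f; exact/val_inj.
have mGk : measurable_fun setT (fun x : measurableTypeR R => G (k * x)%R).
  by apply: (measurableT_comp mG); exact: mulrl_measurable.
rewrite (ge0_integralZl _ measurableT mGk (fun x _ => G0 _) kn0).
rewrite (ge0_integral_lebesgue_scale k0 mG G0) muleA -EFinM.
by rewrite -!exprVn exprSr.
Qed.

End lebesgue_scaling.

(** A first-order expansion whose remainder is still of order [s] after division by [s], as the
    limit in the noise bound requires. *)
Lemma expr1D_le_quadratic {R : realType} (n : nat) :
  exists2 C : R, 0 <= C &
    forall s, 0 <= s -> s <= 1 -> (1 + s) ^+ n <= 1 + n%:R * s + C * s ^+ 2.
Proof.
elim: n => [|n [C C0 ih]]; first by exists 0 => // s _ _; rewrite expr0; lra.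
(* Multiplying by [1 + s] creates [(n + C) * s ^+ 2 + C * s ^+ 3], and [s ^+ 3 <= s ^+ 2]. *)
exists (n%:R + 2 * C) => [|s s0 s1]; first by rewrite addr_ge0 ?mulr_ge0.
rewrite exprS -natr1.
have := ler_wpM2l (addr_ge0 ler01 s0) (ih _ s0 s1).
have : 0 <= C * s ^+ 2 * (1 - s) by rewrite !mulr_ge0 ?sqr_ge0 ?subr_ge0.
by lra.
Qed.

(** * Mean norm of the exponential noise *)

Section exponential_noise.
Context {R : realType} {d : nat}.
Implicit Types (a b : R) (t : d.-tuple R).

Lemma measurable_enorm_row_of_tuple :
  measurable_fun setT (fun t => enorm (row_of_tuple t)).
Proof.
have md : measurable_fun setT
    (fun t : d.-tuple R => dotp (row_of_tuple t) (row_of_tuple t)).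
  rewrite (_ : (fun t => _) = fun t => \sum_(i < d) (tnth t i * tnth t i)).
    apply: measurable_sum => i.
    by apply: measurable_funM; exact: measurable_tnth.
  by apply/funext => t; apply: eq_bigr => i _; rewrite !mxE.
have ms : measurable_fun setT (@Num.sqrt R).
  by apply: continuous_measurable_fun; exact: sqrt_continuous.
exact: (measurableT_comp ms md).
Qed.

Lemma measurable_expR_enorm a :
  measurable_fun setT (fun t => expR (- (a * enorm (row_of_tuple t)))).
Proof.
apply: measurableT_comp => //; apply: measurableT_comp => //.
by apply: measurable_funM => //; exact: measurable_enorm_row_of_tuple.
Qed.

Lemma enorm_scale_tuple k t : 0 <= k ->
  enorm (row_of_tuple (scale_tuple k t)) = k * enorm (row_of_tuple t).
Proof.
move=> k0; rewrite -[in RHS](ger0_norm k0) -enormZ; congr enorm.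
by apply/rowP => i; rewrite !mxE tnth_map.
Qed.

(** The normalizing integral [Z(a)], taken in the extended reals because its finiteness is not known
    in advance. *)
Definition exp_norm_mass a : \bar R :=
  (\int[lebesgue_tuple d]_t (expR (- (a * enorm (row_of_tuple t))))%:E)%E.

Lemma exp_norm_mass_scale a b : 0 < a -> 0 < b ->
  exp_norm_mass b = (((a / b) ^+ d)%:E * exp_norm_mass a)%E.
Proof.
move=> a0 b0; have ba0 : 0 < b / a by rewrite divr_gt0.
pose f t := (expR (- (a * enorm (row_of_tuple t))))%:E.
have mf : measurable_fun setT f.
  by apply/measurable_EFinP; exact: measurable_expR_enorm.
have f0 t : (0 <= f t)%E by rewrite lee_fin expR_ge0.
transitivity (\int[lebesgue_tuple d]_t f (scale_tuple (b / a) t))%E.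
  apply: eq_integral => t _; rewrite /f enorm_scale_tuple ?(ltW ba0)//.
  by rewrite (mulrA a) (mulrC a) divfK ?gt_eqF.
rewrite (ge0_integral_lebesgue_tuple_scale ba0 mf f0).
by congr (_ * _)%E; rewrite -exprVn invf_div.
Qed.

Context {dp : measure_display} {Omega : measurableType dp}.
Variable P : probability Omega R.

Lemma exp_norm_mean_le (X : {RV P >-> d.-tuple R}) a : 0 < a ->
  has_density_prop X (fun v => expR (- (a * enorm v))) ->
  (\int[P]_w (enorm (row_of_tuple (X w)))%:E <= (d%:R / a)%:E)%E.
Proof.
move=> a0 [c Xc].
pose q b t := expR (- (b * enorm (row_of_tuple t))).
have q0 b t : 0 < q b t by exact: expR_gt0.
have mq b : measurable_fun setT (q b) by exact: measurable_expR_enorm.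
have mEq b : measurable_fun setT (EFin \o q b) by exact/measurable_EFinP.
have mEn : measurable_fun setT
    (fun t : d.-tuple R => (enorm (row_of_tuple t))%:E).
  by apply/measurable_EFinP; exact: measurable_enorm_row_of_tuple.
have n0 t : (0 <= (enorm (row_of_tuple t))%:E)%E by rewrite lee_fin enorm_ge0.
have mass : (\int[lebesgue_tuple d]_t (c * q a t)%:E = 1)%E.
  by rewrite -(Xc setT)// probability_setT.
(* The sign of [c] is not part of the density assumption: it follows from the total mass being 1. *)
have c0 : 0 < c.
  rewrite ltNge; apply/negP => c0; have : (0 < 1 :> \bar R)%E by [].
  rewrite -mass ltNge => /negP; apply.
  rewrite -(integral0 (lebesgue_tuple d) setT).
  apply: integral_le_ge0 => // t; rewrite lee_fin.
  by rewrite mulr_le0_ge0// ltW.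
have cq0 t : 0 <= c * q a t by rewrite mulr_ge0 ?(ltW c0) ?(ltW (q0 _ _)).
have cZE b : (c%:E * exp_norm_mass b =
    \int[lebesgue_tuple d]_t (c * q b t)%:E)%E.
  have c0E : (0 <= c%:E)%E by rewrite lee_fin ltW.
  have qE0 t : (0 <= (q b t)%:E)%E by rewrite lee_fin ltW.
  apply/esym; exact: (ge0_integralZl (lebesgue_tuple d) measurableT (mEq b)
    (fun t _ => qE0 t) c0E).
have cZ : (c%:E * exp_norm_mass a = 1)%E.
  by rewrite cZE mass.
set E := (\int[P]_w _)%E.
have E0 : (0 <= E)%E by apply: integral_ge0 => w _; rewrite lee_fin enorm_ge0.
have EE : E = (\int[lebesgue_tuple d]_t
    ((enorm (row_of_tuple t))%:E * (c * q a t)%:E))%E.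
  have mcq : measurable_fun setT (fun t => c * q a t).
    by apply: measurable_funM.
  rewrite -(ge0_integral_density mcq cq0 Xc mEn n0).
  by rewrite (ge0_integral_distribution _ mEn n0).
have step b : 0 < b -> b < a -> ((a - b)%:E * E + 1 <= ((a / b) ^+ d)%:E)%E.
  move=> b0 ba.
  have -> : ((a / b) ^+ d)%:E = (c%:E * exp_norm_mass b)%E.
    by rewrite (exp_norm_mass_scale a0 b0) muleCA cZ mule1.
  have ab0 : 0 <= a - b by rewrite subr_ge0 ltW.
  have cqE t : (0 <= (c * q a t)%:E)%E by rewrite lee_fin.
  have mcq : measurable_fun setT (fun t => (c * q a t)%:E).
    by apply/measurable_EFinP; apply: measurable_funM.
  have mncq : measurable_fun setT
      (fun t => ((enorm (row_of_tuple t))%:E * (c * q a t)%:E)%E).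
    exact: emeasurable_funM.
  have abE0 : (0 <= (a - b)%:E)%E by rewrite lee_fin.
  have ncq0 t : (0 <= (enorm (row_of_tuple t))%:E * (c * q a t)%:E)%E.
    exact: mule_ge0.
  rewrite EE -mass.
  rewrite -(ge0_integralZl _ measurableT mncq (fun t _ => ncq0 t) abE0).
  rewrite -(ge0_integralD _ measurableT (fun t _ => mule_ge0 abE0 (ncq0 t))
    (measurable_funeM _ mncq) (fun t _ => cqE t) mcq).
  rewrite cZE.
  apply: integral_le_ge0 => t; first by rewrite lee_fin mulr_ge0 ?ltW.
  rewrite -!EFinM -EFinD lee_fin.
  set r := enorm _; rewrite /q -/r.
  have -> : - (b * r) = - (a * r) + (a - b) * r by ring.
  rewrite expRD.
  have := ler_wpM2l (cq0 t) (expR_ge1Dx ((a - b) * r)).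
  by rewrite /q -/r; lra.
(* The case [b = a / 2] of [step] already shows that the mean is finite. *)
have [e e0 Ee] : exists2 e, 0 <= e & E = e%:E.
  have a2 : 0 < a / 2 by rewrite divr_gt0.
  have := step _ a2 ltac:(lra).
  clear EE step; case: E E0 => [e e0 _||]; first by exists e.
  - by rewrite gt0_muley// lte_fin; lra.
  - by [].
rewrite Ee lee_fin ler_pdivlMr//.
(* With [b = a / (1 + s)], multiplying [step] by [1 + s] clears the denominator in [a - b] and
   raises the exponent to [d.+1]. The result is [1 + s + s * (e * a) <= (1 + s) ^+ d.+1], whose
   first-order terms give [e * a <= d + C * s]. *)
have [C C0 hC] := @expr1D_le_quadratic R d.+1.
apply: (@le_of_harmonic_error _ _ _ C) => n.
set s : R := n.+1%:R^-1.
have s0 : 0 < s by rewrite invr_gt0.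
have s1 : s <= 1 by rewrite invf_le1// ler1n.
have s10 : 0 < 1 + s by rewrite addr_gt0.
have b0 : 0 < a / (1 + s) by rewrite divr_gt0.
have ba : a / (1 + s) < a by rewrite ltr_pdivrMr// ltr_pMr// ltrDl.
have := step _ b0 ba.
rewrite Ee -EFinM -EFinD lee_fin invf_div mulrCA divff ?gt_eqF// mulr1.
rewrite -(ler_pM2l s10) -exprS => /le_trans/(_ (hC _ (ltW s0) s1)).
have -> : (1 + s) * ((a - a / (1 + s)) * e + 1) = 1 + s + s * (e * a).
  by field; rewrite gt_eqF.
rewrite -natr1 => h; rewrite -(ler_pM2l s0).
by move: h; rewrite expr2; lra.
Qed.

End exponential_noise.

(** * Expected excess risk *)

Section empirical_risk_lemmas.
Context {R : realType} {d m : nat}.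

Lemma empirical_risk_lipschitz (l : 'I_m -> 'rV[R]_d -> R) (L : R) v k :
  (0 < m)%N -> (forall i, lipschitz_in setT L (l i)) ->
  empirical_risk l (v + k) <= empirical_risk l v + L * enorm k.
Proof.
move=> m0 llip; have M0 : 0 < m%:R :> R by rewrite ltr0n.
rewrite /empirical_risk ler_pdivrMl// mulrDr mulVKf ?gt_eqF//.
have -> : m%:R * (L * enorm k) = \sum_(i < m) L * enorm k.
  by rewrite sumr_const card_ord mulr_natl.
rewrite -big_split/=.
apply: ler_sum => i _; rewrite -lerBlDl (le_trans (ler_norm _))//.
by rewrite (le_trans (llip i _ _ _ _))// addrC addKr.
Qed.

End empirical_risk_lemmas.

(** A function of [tau] is a finite combination of indicators of the events where [tau] equals [s],
    which gives both measurability and the mean. *)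
Lemma integral_uniform_perm {R : realType} {dp : measure_display}
    {Omega : measurableType dp} (P : probability Omega R) (m : nat)
    (tau : Omega -> 'S_m) (A : 'S_m -> R) :
  uniform_perm P tau -> (forall s, 0 <= A s) ->
  measurable_fun setT (fun w => (A (tau w))%:E) /\
  (\int[P]_w (A (tau w))%:E)%E = ((m`!%:R)^-1 * \sum_s A s)%:E.
Proof.
move=> utau A0.
have mtau s : measurable (tau @^-1` [set s]) by have [] := utau s.
have mind s : measurable_fun setT
    (fun w => (A s * \1_(tau @^-1` [set s]) w)%:E).
  by apply/measurable_EFinP; apply: measurable_funM.
have AE : (fun w => (A (tau w))%:E) =
    (fun w => \sum_(s : 'S_m) (A s * \1_(tau @^-1` [set s]) w)%:E)%E.
  apply/funext => w; rewrite sumEFin (bigD1 (tau w))//= big1 ?addr0.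
    by rewrite indicE mem_set// mulr1.
  move=> s stau; rewrite indicE memNset ?mulr0//= => tw.
  by rewrite tw eqxx in stau.
rewrite AE; split; first exact: emeasurable_sum.
rewrite ge0_integral_sum//; last first.
  by move=> s w _; rewrite lee_fin mulr_ge0.
rewrite mulr_sumr -sumEFin; apply: eq_bigr => s _.
under eq_integral do rewrite EFinM.
rewrite ge0_integralZl//; last 2 first.
- exact/measurable_EFinP.
- by rewrite lee_fin.
have [_ Ps] := utau s; rewrite integral_indic// setIT.
by rewrite mulrC EFinM; congr (_ * _)%E.
Qed.

Theorem theorem10 (R : realType) (d m : nat) (L rad beta eps : R)
    (W : set 'rV[R]_d)
    (l : 'I_m -> 'rV[R]_d -> R)
    (x : 'I_m -> 'rV[R]_d) (lbar : 'I_m -> R -> R) (rho : 'rV[R]_d -> R)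
    (w1 : 'rV[R]_d) (eta Lstar : R)
    (dp : measure_display) (Omega : measurableType dp) (P : probability Omega R)
    (tau : Omega -> 'S_m) (kappa : {RV P >-> d.-tuple R})
    (hd : (1 <= d)%N) (hm : (1 <= m)%N)
    (hL : 0 < L) (hrad : 0 < rad) (hbeta : 0 < beta) (heps : 0 < eps)
    (hW0 : W !=set0) (hWcl : closed W)
    (hWcvx : @convex_set R 'rV[R]_d W)
    (hWrad : forall w, W w -> enorm w <= rad)
    (hldiff : forall i w, differentiable (l i) w)
    (hlform : forall i w, l i w = lbar i (dotp w (x i)) + rho w)
    (hx : forall i, enorm (x i) <= 1)
    (hlbar : forall i, L.-lipschitz (lbar i))
    (hlcvx : forall i, convex_in W (l i))
    (hllip : forall i, lipschitz_in setT L (l i))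
    (hlsmooth : forall i, smooth_in W beta (l i))
    (hlbound : forall i w, W w -> `|l i w| <= rad)
    (hLstar : is_min_on W (empirical_risk l) Lstar)
    (heta : eta = rad / (L * Num.sqrt m%:R))
    (hetabeta : eta <= 2 / beta)
    (hw1 : W w1)
    (htau : uniform_perm P tau)
    (hindep : independent_of tau kappa)
    (hkappa : has_density_prop kappa
      (fun v => expR (- (eps * enorm v / (2 * L * eta))))) :
  ('E_P[(fun omega =>
      empirical_risk l (sgd_average W eta w1 l (tau omega)
                        + row_of_tuple (kappa omega)) - Lstar)%R]
   <= ((L + 2 * (12 + Num.sqrt 2 * L)) * rad / Num.sqrt m%:R
       + 2 * d%:R * L * rad / (eps * Num.sqrt m%:R))%:E)%E.
Proof.
have sqm0 : 0 < Num.sqrt m%:R :> R by rewrite sqrtr_gt0 ltr0n.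
have eta0 : 0 < eta by rewrite heta divr_gt0 ?mulr_gt0.
have etabeta : eta * beta <= 2 by rewrite -ler_pdivlMr.
have [[u Wu uE] minL] := hLstar.
pose A tau := empirical_risk l (sgd_average W eta w1 l tau) - Lstar.
(* The noiseless average is in [W] by convexity, so its risk is at least [Lstar]; the integrals
   below are then those of nonnegative functions. *)
have A0 s : 0 <= A s.
  rewrite subr_ge0; apply: minL.
  apply: (@convex_set_average _ _ _ hWcvx m (fun t =>
    sgd_iterate W eta w1 (take t [seq l (s i) | i <- enum 'I_m]))) => // t.
  exact: (sgd_iterate_in hW0 hWcl hWrad).
have [mA intA] := integral_uniform_perm htau A0.
have mk : measurable_fun setT (fun w => (enorm (row_of_tuple (kappa w)))%:E).
  apply/measurable_EFinP.
  exact: (measurableT_comp measurable_enorm_row_of_tuple).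
have k0 w : (0 <= (enorm (row_of_tuple (kappa w)))%:E)%E.
  by rewrite lee_fin enorm_ge0.
have AE0 w : (0 <= (A (tau w))%:E)%E by rewrite lee_fin.
have L0 : (0 <= L%:E)%E by rewrite lee_fin ltW.
have Lk0 w : (0 <= L%:E * (enorm (row_of_tuple (kappa w)))%:E)%E.
  exact: mule_ge0.
rewrite unlock.
(* The Lipschitz bound on the whole space separates the excess risk pointwise into a term in [tau]
   and a term in [kappa]. *)
apply: (@le_trans _ _ (\int[P]_w
    ((A (tau w))%:E + L%:E * (enorm (row_of_tuple (kappa w)))%:E)))%E.
  apply: integral_le_ge0 => w; first exact: adde_ge0.
  rewrite -EFinM -EFinD lee_fin /A addrAC lerD2r.
  exact: empirical_risk_lipschitz.
rewrite (ge0_integralD _ measurableT (fun w _ => AE0 w) mA (fun w _ => Lk0 w)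
  (measurable_funeM _ mk)).
rewrite (ge0_integralZl _ measurableT mk (fun w _ => k0 w) L0).
pose a := eps / (2 * L * eta).
have a0 : 0 < a by rewrite divr_gt0 ?mulr_gt0.
have noise : (\int[P]_w (enorm (row_of_tuple (kappa w)))%:E <= (d%:R / a)%:E)%E.
  apply: exp_norm_mean_le => //.
  have [c hc] := hkappa; exists c => B mB; rewrite (hc _ mB).
  by apply: eq_integral => t _; rewrite /a mulrAC.
have risk : m`!%:R^-1 * \sum_s A s <=
    2 * rad ^+ 2 / (eta * m%:R) + 3 / 2 * L ^+ 2 * eta.
  rewrite ler_pdivrMl ?ltr0n ?fact_gt0// -(card_Sn m) /A -uE.
  exact: (sum_excess_risk_le hW0 hWcl hWcvx hWrad (ltW hL) (ltW hbeta) eta0).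
rewrite intA; apply: le_trans (leeD (lexx _) (lee_wpmul2l L0 noise)) _.
rewrite -EFinM -EFinD lee_fin; apply: lerD.
  apply: (le_trans risk).
  (* For this [eta] the two terms are 2 and 3/2 times [L * rad / Num.sqrt m%:R]. *)
  have -> : 2 * rad ^+ 2 / (eta * m%:R) + 3 / 2 * L ^+ 2 * eta =
      7 / 2 * L * rad / Num.sqrt m%:R.
    have mE : m%:R = Num.sqrt m%:R ^+ 2 :> R by rewrite sqr_sqrtr.
    rewrite heta; set q := Num.sqrt m%:R in mE sqm0 *; rewrite mE; field.
    by rewrite !gt_eqF.
  rewrite ler_pM2r ?invr_gt0// ler_pM2r//.
  (* This gives [7 / 2 <= 1 + 2 * Num.sqrt 2]; the summand 24 of the target is slack. *)
  have : 5 / 4 <= Num.sqrt 2 :> R.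
    rewrite -(ler_pXn2r (ltn0Sn 1)) ?nnegrE ?sqrtr_ge0 ?divr_ge0//.
    by rewrite sqr_sqrtr//; lra.
  by move=> /(ler_wpM2r (ltW hL)); lra.
(* The noise term [L * (d%:R / a)] equals the second summand of the bound exactly. *)
rewrite /a heta le_eqVlt; apply/orP; left; apply/eqP; field.
by rewrite !gt_eqF.
Qed.
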